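(* Let $s\in\Sigma^n$ be primitive, and suppose $BWT_{*}(s)$ is based on a local ordering and supports constant-time rank queries. After an ${\cal O}(\sigma^2)$-time preprocessing, given any string $x=x_1x_2\cdots x_p$, the range $R[x]$ of rows of $M_{*}(s)$ prefixed by $x$ can be computed in ${\cal O}(p)$ time and ${\cal O}(\sigma^2+p)$ space.
   Context: For every string $y$ over $\Sigma$ ($|\Sigma|=\sigma$) let $\pi_y$ be a total order of $\Sigma$. $M_{*}(s)$ is the matrix whose rows (numbered $1,\dots,n$ top to bottom) are the cyclic rotations of $s$ (primitive: all rotations distinct), sorted so that for distinct rotations $u\neq v$ with longest common prefix $y$ and next symbols $a$ (in $u$) and $b$ (in $v$), $u$ precedes $v$ iff $a$ precedes $b$ in $\pi_y$; $BWT_{*}(s)=L$ is its last column. Local ordering: there are orders $\pi_\epsilon$ and $\pi_c$ ($c\in\Sigma$) with $\pi_y=\pi_\epsilon$ for empty $y$ and $\pi_y=\pi_c$ if $y$ is nonempty ending with $c$. $R[x]=[b_x,\ell_x]$ means row $j$ is prefixed by $x$ iff $b_x\le j<b_x+\ell_x$ ($[0,0]$ if none). Constant-time rank: $\mathsf{rank}_c(L,j)$ (number of $c$'s in $L[1,j]$) in ${\cal O}(1)$ time. Model: word RAM with word size $w$, $\sigma=w^{{\cal O}(1)}$. *)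

(* Defs.v *)
From mathcomp Require Import all_boot.

Set Implicit Arguments.
Unset Strict Implicit.
Unset Printing Implicit Defensive.

Section Transform.
Variable T : eqType.
Implicit Types (s u v x y : seq T) (M : seq (seq T)) (pi : seq T -> rel T).

Definition rotations s := [seq rot i s | i <- iota 0 (size s)].

Definition primitive_string s := (0 < size s) && uniq (rotations s).

Definition total_order (r : rel T) :=
  [/\ reflexive r, antisymmetric r, transitive r & total r].

Fixpoint lcp u v : seq T :=
  match u, v with
  | a :: u', b :: v' => if a == b then a :: lcp u' v' else [::]
  | _, _ => [::]
  end.

(* The orders are given in their reflexive form, hence the test a != b.       *)
Definition precedes pi u v : bool :=
  let y := lcp u v in
  match drop (size y) u, drop (size y) v with
  | a :: _, b :: _ => (a != b) && pi y a b
  | _, _ => false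
  end.

Definition Mstar pi s : seq (seq T) :=
  sort (fun u v => (u == v) || precedes pi u v) (rotations s).

(* Rows are nonempty as soon as s is, so pmap drops nothing.                  *)
Definition BWTstar pi s : seq T :=
  pmap (fun u => ohead (rev u)) (Mstar pi s).

Definition local_ordering pi (pi_eps : rel T) (pi_sym : T -> rel T) :=
  (pi [::] =2 pi_eps) /\ (forall y c, pi (rcons y c) =2 pi_sym c).

(* Rows are numbered from 1.                                                  *)
Definition is_range M x (b l : nat) : Prop :=
  if has (prefix x) M then
    forall j, (0 < j <= size M) && prefix x (nth [::] M j.-1) = (b <= j < b + l)
  else b = 0 /\ l = 0.

End Transform.

(* Word RAM: registers and memory cells hold naturals below 2 ^ w, addresses  *)
(* are words, and a program is a fixed finite list of unit-cost instructions. *)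
(* A run has a read-only input array and a unit-cost rank oracle.             *)
Inductive binop :=
  Add | Sub | Mul | Div | Mod | And | Or | Xor | Shl | Shr.

Inductive instr :=
  | Const of nat & nat          (* r := k                              *)
  | Move of nat & nat           (* r := r1                             *)
  | Op of binop & nat & nat & nat (* r := r1 op r2                     *)
  | ReadMem of nat & nat        (* r := memory[r1]                     *)
  | WriteMem of nat & nat       (* memory[r1] := r2                    *)
  | ReadInput of nat & nat      (* r := input[r1], 0 past the end      *)
  | Rank of nat & nat & nat     (* r := rank_{r1}(L, r2)               *)
  | Jump of nat
  | JumpEq of nat & nat & nat   (* if r1 = r2 goto k                   *)
  | JumpLt of nat & nat & nat.  (* if r1 < r2 goto k                   *)

Definition program := seq instr.

(* top is one more than the largest memory address accessed so far.           *)
Record config := Config {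
  pc : nat; regs : nat -> nat; memory : nat -> nat; top : nat }.

Definition upd (f : nat -> nat) (i v : nat) : nat -> nat :=
  fun j => if j == i then v else f j.

Section Machine.
Variables (w : nat) (inp : seq nat) (rk : nat -> nat -> nat).

Definition wrap (k : nat) : nat := k %% 2 ^ w.

Definition eval_op (o : binop) (a b : nat) : nat :=
  wrap match o with
  | Add => a + b
  | Sub => a + 2 ^ w - b
  | Mul => a * b
  | Div => a %/ b
  | Mod => a %% b
  | And => Nat.land a b
  | Or  => Nat.lor a b
  | Xor => Nat.lxor a b
  | Shl => a * 2 ^ b
  | Shr => a %/ 2 ^ b
  end.

Definition exec (i : instr) (cf : config) : config :=
  let: Config p r m t := cf in
  match i with
  | Const d k => Config p.+1 (upd r d (wrap k)) m t
  | Move d a => Config p.+1 (upd r d (r a)) m t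
  | Op o d a b => Config p.+1 (upd r d (eval_op o (r a) (r b))) m t
  | ReadMem d a => Config p.+1 (upd r d (m (r a))) m (maxn t (r a).+1)
  | WriteMem a b => Config p.+1 r (upd m (r a) (r b)) (maxn t (r a).+1)
  | ReadInput d a => Config p.+1 (upd r d (nth 0 inp (r a))) m t
  | Rank d a b => Config p.+1 (upd r d (rk (r a) (r b))) m t
  | Jump k => Config k r m t
  | JumpEq a b k => Config (if r a == r b then k else p.+1) r m t
  | JumpLt a b k => Config (if r a < r b then k else p.+1) r m t
  end.

Variable P : program.

Definition halted (cf : config) : bool := size P <= pc cf.

(* A halted configuration is a fixed point, so being halted after t steps     *)
(* means that the running time is at most t.                                  *)
Definition step (cf : config) : config :=
  if onth P (pc cf) is Some i then exec i cf else cf.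

Definition run (t : nat) (cf : config) : config := iter t step cf.

End Machine.

(* The first registers hold the listed arguments, the others 0.               *)
Definition start (args : seq nat) (m : nat -> nat) (t : nat) : config :=
  Config 0 (nth 0 args) m t.

Section Encoding.
Variable sigma : nat.

Definition code (x : seq 'I_sigma) : seq nat := [seq val a | a <- x].

Definition rank (L : seq 'I_sigma) (c j : nat) : nat :=
  count_mem c (take j (code L)).

Definition increasing_list (r : rel 'I_sigma) : seq 'I_sigma :=
  sort r (enum 'I_sigma).

(* Entry i is the i-th symbol for pi_eps; entry sigma * c.+1 + i is the i-th  *)
(* symbol for pi_sym c (everything counted from 0).                           *)
Definition order_table (pi_eps : rel 'I_sigma)
    (pi_sym : 'I_sigma -> rel 'I_sigma) : seq nat :=
  code (increasing_list pi_eps ++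
        flatten [seq increasing_list (pi_sym c) | c <- enum 'I_sigma]).

(* Starting from memory m, whose first t cells hold the data structure, the   *)
(* queries xs are answered one after the other, each in the memory left by    *)
(* the previous one. The space of a query comprises the data structure, the   *)
(* working memory and the size x words of the input.                          *)
Fixpoint answers (w n : nat) (M : seq (seq 'I_sigma)) (L : seq 'I_sigma)
    (query : program) (C t : nat) (m : nat -> nat)
    (xs : seq (seq 'I_sigma)) : Prop :=
  if xs is x :: xs' then
    let cf := run w (code x) (rank L) query (C * maxn 1 (size x))
                (start [:: n; sigma; size x] m t) in
    [/\ halted query cf,
        is_range M x (regs cf 0) (regs cf 1),
        size x + top cf <= C * (sigma ^ 2 + size x) &
        answers w n M L query C t (memory cf) xs']
  else True.

End Encoding.

(* Main.v *)
(* Let B x be the number of rows of M preceding all extensions of x, and l x  *)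

(* Write B x for [first_row x] and l x for [num_rows x]. The rows before x, and those before or
   prefixed by x, form initial segments of the matrix ([prec_down], [prec_prefix_down]). So
   [is_range_first_row] reads R[x] off B x and l x, and the ranks of c at B x and B x + l x count
   the rows of these segments that end with c. Rotation permutes the rows ([count_rot]), which turns
   such counts into counts of rows starting with c: this is [num_rows_cons] for l (c x). For B,
   locality makes words compare alike after c a and after a, so the rows separating c a x from c a
   correspond to those separating a x from a and ending with c ([first_row_cons]).

   The constants B (c a) - rank_c (B a) come from partial sums along the orders ([first_row1_next],
   [first_row2_next]). They may be negative; kept modulo 2 ^ w, they still yield the exact value of
   B (c a x), which is below 2 ^ w ([sub_add_wrap]). The runs ([preprocess_run], [query_run]) are
   analysed for an abstract rank oracle and tied to the matrix in [query_correct]. *)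
(* the number of rows prefixed by x, so that R[x] starts at row B x + 1.      *)
(* Rotating a row of R[a x] ending with c by one position to the right gives  *)
(* a row of R[c a x]; as the order of two rows sharing a nonempty prefix only *)
(* depends on the last symbol of their common prefix, this rotation is order  *)
(* preserving. Hence B (c a x) - B (c a) = rank_c (B (a x)) - rank_c (B a)    *)
(* and l (c x) = rank_c (B x + l x) - rank_c (B x), so x can be scanned       *)
(* backwards with two rank queries per symbol once the constants              *)
(* B (c a) - rank_c (B a) are tabulated. The latter only need sums of l a and *)
(* l (c a) along the orders pi_eps and pi_c. None of this requires l x to be  *)
(* nonzero, but it does require size x <= n.                                  *)
Require Import Defs.
From mathcomp Require Import all_boot.
From mathcomp Require Import zify.

Set Implicit Arguments.
Unset Strict Implicit.
Unset Printing Implicit Defensive.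

(* Cell c receives B c (instructions 1-8), cell sigma * (c + 1) + a receives  *)
(* B (c a) - rank_c (B a) modulo 2 ^ w (rows c: 11-31, entries of a row:      *)
(* 15-28). Registers: 2 accumulator, 3 position in the order table, 4 c,      *)
(* 6 one, 7 base of the current row, 8 end of that row, 9 a.                  *)
Definition preprocess_program : program := [::
  Const 6 1;
  JumpLt 3 1 3;
  Jump 9;
  ReadInput 4 3;
  WriteMem 4 2;
  Rank 5 4 0;
  Op Add 2 2 5;
  Op Add 3 3 6;
  Jump 1;
  Move 7 1;
  Const 4 0;
  JumpLt 4 1 13;
  Jump 32;
  ReadMem 2 4;
  Op Add 8 7 1;
  JumpLt 3 8 17;
  Jump 29;
  ReadInput 9 3;
  ReadMem 10 9;
  Rank 11 9 0;
  Op Add 11 10 11;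
  Rank 12 4 10;
  Rank 13 4 11;
  Op Defs.Sub 5 2 12;
  Op Add 14 7 9;
  WriteMem 14 5;
  Op Add 2 5 13;
  Op Add 3 3 6;
  Jump 15;
  Move 7 8;
  Op Add 4 4 6;
  Jump 11].

(* Registers: 3 position in x, 4 current symbol c, 5 B, 6 one, 7 l, 8 the     *)
(* symbol following c, 13 zero. The main loop is 14-27; 4-6 answers the empty *)
(* query and 7-9 returns the empty range.                                     *)
Definition query_program : program := [::
  JumpEq 2 13 4;
  JumpLt 0 2 7;
  Const 6 1;
  Jump 10;
  Move 1 0;
  Const 0 1;
  Jump 31;
  Const 0 0;
  Const 1 0;
  Jump 31;
  Op Defs.Sub 3 2 6;
  ReadInput 4 3;
  ReadMem 5 4;
  Rank 7 4 0;
  JumpEq 3 13 28;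
  Move 8 4;
  Op Defs.Sub 3 3 6;
  ReadInput 4 3;
  Op Add 9 5 7;
  Rank 10 4 5;
  Rank 11 4 9;
  Op Defs.Sub 7 11 10;
  Op Mul 12 4 1;
  Op Add 12 12 1;
  Op Add 12 12 8;
  ReadMem 5 12;
  Op Add 5 5 10;
  Jump 14;
  JumpEq 7 13 7;
  Op Add 0 5 6;
  Move 1 7].

(** * Execution of programs: composition, halting, loops *)

Section Runs.
Variables (w : nat) (inp : seq nat) (rk : nat -> nat -> nat) (P : program).
Local Notation run := (run w inp rk P).

Lemma runD k l cf : run (k + l) cf = run l (run k cf).
Proof. by rewrite /Defs.run addnC iterD. Qed.

Lemma runS k cf : run k.+1 cf = run k (step w inp rk P cf).
Proof. by rewrite /Defs.run iterSr. Qed.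

Lemma run0 cf : run 0 cf = cf.
Proof. by []. Qed.

Lemma run_halted k l cf :
  k <= l -> halted P (run k cf) -> run l cf = run k cf.
Proof.
move=> /subnKC <-; rewrite runD; set cf' := run k cf => halt.
elim: (l - k) => // j IH; rewrite runS /step.
by move: halt; rewrite /halted leqNgt -onthTE; case: onth.
Qed.

Lemma run_iter (Inv : nat -> config -> Prop) N k cf :
  (forall i cf, i < N -> Inv i cf -> Inv i.+1 (run k cf)) ->
  Inv 0 cf -> Inv N (run (N * k) cf).
Proof.
move=> step_inv inv0; elim: {-2}N (leqnn N) => // i IH lt_iN.
by rewrite mulSn addnC runD; apply/step_inv/IH/ltnW.
Qed.

End Runs.

Arguments run : simpl never.
Arguments eval_op : simpl never.
Arguments upd _ _ _ _ /.

Ltac exec1 := rewrite runS /step /=.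
Ltac exec_done := rewrite run0 /=.

Section Words.
Variable w : nat.

Lemma wrap_small k : k < 2 ^ w -> Defs.wrap w k = k.
Proof. exact: modn_small. Qed.

Lemma add_small a b : a + b < 2 ^ w -> eval_op w Add a b = a + b.
Proof. exact: wrap_small. Qed.

Lemma sub_small a b : b <= a < 2 ^ w -> eval_op w Defs.Sub a b = a - b.
Proof.
move=> /andP[le_ba lt_a]; rewrite /eval_op /Defs.wrap -addnBAC // modnDr.
by rewrite modn_small //; lia.
Qed.

End Words.

(** * The preprocessing run, for an abstract rank oracle *)

Section Preprocess.
Variables (w : nat) (inp : seq nat) (rk : nat -> nat -> nat) (n sigma : nat).
Hypothesis sigma_gt0 : 0 < sigma.
Hypothesis sigma_word : sigma ^ 2 + sigma < 2 ^ w.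
Local Notation add := (eval_op w Add).
Local Notation sub := (eval_op w Defs.Sub).
Local Notation sym r k := (nth 0 inp (sigma * r + k)).
Hypothesis sym_lt : forall r k, r <= sigma -> k < sigma -> sym r k < sigma.
Hypothesis sym_inj : forall r k k', r <= sigma -> k < sigma -> k' < sigma ->
  sym r k = sym r k' -> k = k'.

Lemma lt2w k : k <= sigma ^ 2 + sigma -> k < 2 ^ w.
Proof. by move=> /leq_ltn_trans; apply. Qed.

(* The accumulators are in machine arithmetic: the run can then be described   *)
(* without excluding overflows.                                                *)
Fixpoint acc1 k :=
  if k is k'.+1 then add (acc1 k') (rk (sym 0 k') n) else 0.

(** The subtraction leaves the table entry of the pair c a; adding the rank at the end of R[a] then
    gives B (c a) + l (c a), the sum for the next symbol. *)
Fixpoint acc2 (b : nat -> nat) c k :=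
  if k is k'.+1 then
    let a := sym c.+1 k' in
    add (sub (acc2 b c k') (rk c (b a))) (rk c (add (b a) (rk a n)))
  else b c.

Definition singles_inv i cf :=
  let: Config p r m t := cf in
  [/\ p = 1, [/\ r 0 = n, r 1 = sigma, r 2 = acc1 i, r 3 = i & r 6 = 1],
      t <= sigma ^ 2 + sigma & forall k, k < i -> m (sym 0 k) = acc1 k].

Arguments singles_inv : simpl never.

Local Notation prun := (run w inp rk preprocess_program).

Lemma singles_inv_step i cf : i < sigma -> singles_inv i cf -> singles_inv i.+1 (prun 7 cf).
Proof.
case: cf => p r m t lt_i [-> [r0 r1 r2 r3 r6] le_t mE].
exec1; rewrite r1 r3 lt_i.
do 6!exec1.
rewrite /singles_inv; exec_done; rewrite r0 r2 r3 r6 (@add_small w _ 1 (lt2w _)); last by nia.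
have lt_sym : nth 0 inp i < sigma by have := sym_lt (leq0n _) lt_i; rewrite muln0.
rewrite !muln0 !add0n addn1; split=> //; first by nia.
move=> k le_ki; rewrite add0n; case: eqP => [eq_sym|neq].
  by rewrite (@sym_inj 0 k i) ?muln0 //; lia.
have neq_ki : k <> i by move=> eq_ki; case: neq; rewrite eq_ki.
by rewrite -(mE k) ?muln0 ?add0n //; lia.
Qed.

(** [N] counts the pairs treated so far, in the order of the order table; an entry is addressed by
    its symbol, not by the position [k] of that symbol. *)
Definition table_upto (b m : nat -> nat) N :=
  (forall a, a < sigma -> m a = b a) /\
  (forall c k, c < sigma -> k < sigma -> sigma * c + k < N ->
     m (sigma * c.+1 + sym c.+1 k) = sub (acc2 b c k) (rk c (b (sym c.+1 k)))).

Definition pairs_inv b c cf :=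
  let: Config p r m t := cf in
  [/\ p = 11, [/\ r 0 = n, r 1 = sigma & r 6 = 1],
      [/\ r 3 = sigma * c.+1, r 4 = c & r 7 = sigma * c.+1],
      t <= sigma ^ 2 + sigma & table_upto b m (sigma * c)].

Definition pair_row_inv b c j cf :=
  let: Config p r m t := cf in
  [/\ p = 15, [/\ r 0 = n, r 1 = sigma, r 2 = acc2 b c j & r 6 = 1],
      [/\ r 3 = sigma * c.+1 + j, r 4 = c, r 7 = sigma * c.+1
        & r 8 = sigma * c.+1 + sigma],
      t <= sigma ^ 2 + sigma & table_upto b m (sigma * c + j)].

Arguments pairs_inv : simpl never.
Arguments pair_row_inv : simpl never.

(** Uniqueness of base [sigma] digits: writing one entry leaves the others intact. *)
Lemma addr_inj c a c' a' : a < sigma -> a' < sigma ->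
  sigma * c + a = sigma * c' + a' -> c = c' /\ a = a'.
Proof.
move=> lt_a lt_a' eq_addr.
move/(congr1 (divn^~ sigma)): (eq_addr); rewrite ![sigma * _]mulnC !divnMDl //.
by rewrite !divn_small // !addn0 => eq_c; subst c'; split=> //; lia.
Qed.

Lemma pair_row_inv_step b c j cf : c < sigma -> j < sigma ->
  pair_row_inv b c j cf -> pair_row_inv b c j.+1 (prun 13 cf).
Proof.
case: cf => p r m t lt_c lt_j.
move=> [-> [r0 r1 r2 r6] [r3 r4 r7 r8] le_t [mb mE]].
exec1; rewrite r3 r8 ltn_add2l lt_j.
do 12!exec1; rewrite /pair_row_inv; exec_done; rewrite r0 r2 r3 r4 r6 r7.
have lt_sym := sym_lt lt_c lt_j.
rewrite !mb // (@add_small w _ 1 (lt2w _)); last by nia.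
rewrite [add _ (sym _ _)](add_small (lt2w _)); last by nia.
split=> //; first by split=> //; lia.
  by nia.
split=> [a lt_a|c' k lt_c' lt_k lt_N] /=.
  by case: eqP => [eq_a|_]; [nia | exact: mb].
have lt_sym' := sym_lt lt_c' lt_k.
case: eqP => [/addr_inj[] // [->] /sym_inj -> //|neq].
apply: mE => //; rewrite addnS ltnS leq_eqVlt in lt_N.
by case/orP: lt_N => // /eqP /addr_inj[] // eq_c eq_k; case: neq; rewrite eq_c eq_k.
Qed.

Lemma pairs_inv_step b c cf : c < sigma ->
  pairs_inv b c cf -> pairs_inv b c.+1 (prun (3 + sigma * 13 + 5) cf).
Proof.
move=> lt_c inv; rewrite !runD.
have pair_row_inv0 : pair_row_inv b c 0 (prun 3 cf).
  move: inv; case: cf => p r m t [-> [r0 r1 r6] [r3 r4 r7] le_t [mb mE]].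
  exec1; rewrite r1 r4 lt_c.
  do 2!exec1; rewrite /pair_row_inv; exec_done; rewrite r0 r1 r3 r4 r6 r7 addn0.
  rewrite (add_small (lt2w _)) ?mb //; last by nia.
  by split=> //; [nia | split=> //; rewrite addn0].
have := run_iter (fun j cf lt_j => @pair_row_inv_step b c j cf lt_c lt_j) pair_row_inv0.
case: (prun _ _) => p r m t [-> [r0 r1 r2 r6] [r3 r4 r7 r8] le_t mE].
exec1; rewrite r3 r8 ltnn.
do 4!exec1; rewrite /pairs_inv; exec_done;
  rewrite r0 r1 r3 r4 r6 r8 -!mulnSr (@add_small w _ 1 (lt2w _)); last by nia.
by rewrite addn1; split=> //; rewrite mulnSr.
Qed.

(** Step count: 1 to initialise, 7 per symbol, 4 between the loops, 3 to enter a row, 13 per pair, 5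
    to leave a row, 2 to exit. The witness [b] is the memory after the first loop. *)
Lemma preprocess_run : exists r m t b,
  [/\ prun (1 + sigma * 7 + 4 + sigma * (3 + sigma * 13 + 5) + 2)
        (start [:: n; sigma] (fun=> 0) 0) = Config 32 r m t,
      t <= sigma ^ 2 + sigma, table_upto b m (sigma ^ 2)
    & forall k, k < sigma -> b (sym 0 k) = acc1 k].
Proof.
rewrite !runD.
have singles_inv0 : singles_inv 0 (prun 1 (start [:: n; sigma] (fun=> 0) 0)).
  rewrite /start; exec1; rewrite /singles_inv; exec_done; split=> //; split=> //.
  by apply/wrap_small/lt2w; nia.
have := run_iter singles_inv_step singles_inv0.
case: (prun _ _) => p r m t [-> [r0 r1 r2 r3 r6] le_t mE].
have pairs_inv0 : pairs_inv m 0 (prun 4 (Config 1 r m t)).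
  exec1; rewrite r1 r3 ltnn; do 3!exec1; rewrite /pairs_inv; exec_done.
  rewrite r0 r1 r3 r6 !muln1.
  split=> //; first by split=> //; apply/wrap_small/lt2w; nia.
  by split=> // c k _ _; rewrite muln0.
have := run_iter (@pairs_inv_step m) pairs_inv0.
case: (prun _ _) => p' r' m' t' [-> [r0' r1' r6'] [r3' r4' r7'] le_t' mE'].
exec1; rewrite r4' r1' ltnn; exec1; rewrite run0.
by exists r', m', t', m; rewrite -mulnn; split.
Qed.

End Preprocess.

(** * The query run, given the recurrences along the suffixes of the input *)

Section Query.
Variables (w : nat) (inp : seq nat) (rk : nat -> nat -> nat) (n sigma : nat).
Variables (m : nat -> nat) (t : nat) (first len : nat -> nat).
Hypothesis sigma_gt0 : 0 < sigma.
Hypothesis sigma_word : sigma ^ 2 + sigma < 2 ^ w.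
Local Notation add := (eval_op w Add).
Local Notation sub := (eval_op w Defs.Sub).
Local Notation qrun := (run w inp rk query_program).
Local Notation q0 := (start [:: n; sigma; size inp] m t).
Local Notation last_pos := (size inp).-1.

Lemma query_run_empty : inp = [::] ->
  exists r, [/\ qrun 4 q0 = Config 31 r m t, r 0 = 1 & r 1 = n].
Proof.
move=> inp0; rewrite /start inp0 /=.
do 4!exec1; exec_done; eexists; split=> //.
by apply: wrap_small; nia.
Qed.

Lemma query_run_long : n < size inp ->
  exists r, [/\ qrun 5 q0 = Config 31 r m t, r 0 = 0 & r 1 = 0].
Proof.
move=> lt_n; rewrite /start; exec1.
rewrite [_ == _]gtn_eqF ?(leq_ltn_trans (leq0n n)) //; exec1; rewrite lt_n.
do 3!exec1; exec_done; eexists; split; rewrite //= wrap_small //; nia.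
Qed.

Hypothesis size_word : size inp < 2 ^ w.
Hypothesis t_le : t <= sigma ^ 2 + sigma.
Hypothesis inp_lt : forall i, i < size inp -> nth 0 inp i < sigma.
Hypothesis first_last : m (nth 0 inp last_pos) = first last_pos.
Hypothesis len_last : rk (nth 0 inp last_pos) n = len last_pos.
Hypothesis first_prev : forall i, i.+1 < size inp ->
  add (m (sigma * (nth 0 inp i).+1 + nth 0 inp i.+1))
      (rk (nth 0 inp i) (first i.+1)) = first i.
Hypothesis len_prev : forall i, i.+1 < size inp ->
  sub (rk (nth 0 inp i) (add (first i.+1) (len i.+1)))
      (rk (nth 0 inp i) (first i.+1)) = len i.

(** [first i] and [len i] stand for B and l of the suffix starting at position i. The memory stays
    equal to [m], so that the next query finds the same table. *)
Definition query_inv j cf :=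
  let: Config p r m' t' := cf in
  let i := last_pos - j in
  [/\ p = 14, [/\ r 0 = n, r 1 = sigma, r 6 = 1 & r 13 = 0],
      [/\ r 3 = i, r 4 = nth 0 inp i, r 5 = first i & r 7 = len i],
      m' = m & t' <= sigma ^ 2 + sigma].

Arguments query_inv : simpl never.

Lemma query_inv_step j cf : j < last_pos -> query_inv j cf -> query_inv j.+1 (qrun 14 cf).
Proof.
case: cf => p r m' t' lt_j.
move=> [-> [r0 r1 r6 r13] [r3 r4 r5 r7] -> le_t'].
have [i iE] : exists i, last_pos - j = i.+1 by exists (last_pos - j).-1; lia.
have iE' : last_pos - j.+1 = i by lia.
have lt_i : i.+1 < size inp by lia.
rewrite iE in r3 r4 r5 r7.
exec1; have -> : (r 3 == r 13) = false by rewrite r3 r13.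
do 13!exec1; rewrite /query_inv; exec_done; rewrite r0 r1 r3 r4 r5 r6 r7 r13 iE'.
have lt_c := inp_lt (ltnW lt_i); have lt_a := inp_lt lt_i.
have subE : sub i.+1 1 = i by rewrite sub_small ?subn1 //; lia.
rewrite subE.
have -> : add (add (eval_op w Mul (nth 0 inp i) sigma) sigma) (nth 0 inp i.+1)
   = sigma * (nth 0 inp i).+1 + nth 0 inp i.+1.
  rewrite [eval_op w Mul _ _]wrap_small; last by nia.
  by rewrite !add_small; nia.
by rewrite first_prev // len_prev //; split=> //; nia.
Qed.

Lemma query_run : 0 < size inp <= n -> (len 0 != 0 -> (first 0).+1 < 2 ^ w) ->
  exists r t',
  [/\ qrun (8 + last_pos * 14 + 5) q0 = Config 31 r m t',
      t' <= sigma ^ 2 + sigma,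
      r 0 = (if len 0 == 0 then 0 else (first 0).+1)
    & r 1 = len 0].
Proof.
move=> /andP[p_gt0 le_pn] first_word; rewrite !runD.
have one_word : Defs.wrap w 1 = 1 by apply: wrap_small; nia.
have query_inv0 : query_inv 0 (qrun 8 q0).
  rewrite /start; exec1; rewrite [_ == _]gtn_eqF //; exec1; rewrite ltnNge le_pn.
  do 6!exec1; rewrite /query_inv; exec_done; rewrite one_word subn0.
  rewrite sub_small ?p_gt0 // subn1.
  have := inp_lt (i := last_pos); rewrite first_last len_last prednK // => /(_ (leqnn _)) lt_a.
  by split=> //; nia.
have := run_iter query_inv_step query_inv0.
case: (qrun _ _) => p r m' t'.
rewrite /query_inv subnn => -[-> [r0 r1 r6 r13] [r3 r4 r5 r7] -> le_t'].
exec1; rewrite r3 r13 eqxx; exec1; rewrite r7 r13.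
case: eqVneq => [len0|/first_word lt_first].
  do 3!exec1; exec_done; eexists _, _; split; first by reflexivity.
  - by [].
  - exact: mod0n.
  - by rewrite len0; exact: mod0n.
(* Only two instructions remain in this branch; the third step idles in the halted configuration. *)
do 3!exec1; exec_done; eexists _, _; split; first by reflexivity.
- by [].
- by rewrite /= r5 r6 add_small addn1.
- by rewrite /= r7.
Qed.

End Query.

(** * Initial segments of a list cut out by a predicate *)

Section Split.
Variable T : Type.
Implicit Types (P Q : pred T) (M : seq T).

Lemma pairwise_filter_cat P M :
  pairwise (fun u v => P v ==> P u) M -> M = filter P M ++ filter (predC P) M.
Proof.
elim: M => //= u M IH /andP[uM /IH defM].
case Pu: (P u) uM => /= uM; first by rewrite -defM.
have PM0 : filter P M = [::].
  by apply/size0nil/eqP; rewrite size_filter eqn0Ngt -has_count -all_predC.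
by rewrite PM0 /= [in LHS]defM PM0.
Qed.

Lemma count_take_pairwise P Q M :
  pairwise (fun u v => P v ==> P u) M ->
  count Q (take (count P M) M) = count (predI Q P) M.
Proof.
move/pairwise_filter_cat=> defM; suff -> : take (count P M) M = filter P M.
  by rewrite count_filter.
by rewrite {2}defM -size_filter take_size_cat.
Qed.

Lemma nth_pairwise x0 P M j :
  pairwise (fun u v => P v ==> P u) M -> j < size M ->
  P (nth x0 M j) = (j < count P M).
Proof.
move/pairwise_filter_cat=> defM lt_j; rewrite {1}defM nth_cat -size_filter.
case: ltnP => [lt_jP|le_Pj]; first exact: (all_nthP x0 (filter_all P M)).
apply/negbTE; apply: (all_nthP x0 (filter_all (predC P) M)).
by rewrite ltn_subLR // -size_cat -defM.
Qed.

End Split.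

Lemma count_add (A : eqType) (M : seq A) (P Q1 Q2 : pred A) :
  {in M, forall u, P u = Q1 u + Q2 u :> nat} ->
  count P M = count Q1 M + count Q2 M.
Proof.
elim: M => //= u M IH PE; rewrite PE ?mem_head // IH; first lia.
by move=> v vM; apply: PE; rewrite inE vM orbT.
Qed.

(** * Comparison of words in a context *)

Section Comparison.
Variables (T : eqType) (pi : seq T -> rel T).
Implicit Types (u v x y : seq T).

(* [prec y u v] compares the words [y ++ u] and [y ++ v]. *)
Fixpoint prec y u v : bool :=
  match u, v with
  | a :: u', b :: v' => if a == b then prec (rcons y a) u' v' else pi y a b
  | _, _ => false
  end.

Lemma precedesE u v : precedes pi u v = prec [::] u v.
Proof.
(* Removing a common first symbol a replaces the family f by z -> f (a z), so the induction runs
   over all families. *)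
suff gen f y : (forall z, f z =2 pi (y ++ z)) -> precedes f u v = prec y u v.
  exact: gen.
elim: u v f y => [|a u IH] [|b v] f y fE; rewrite /precedes //=.
case: eqVneq => [<-|neq_ab] /=; last by rewrite neq_ab fE cats0.
by apply: (IH v (fun z => f (a :: z))) => z c d; rewrite fE cat_rcons.
Qed.

Lemma prefix_prec y x u : prefix x u -> prec y u x = false.
Proof.
by elim: x u y => [|a x IH] [|b u] y //=; rewrite eq_sym; case: eqP => // _ /IH.
Qed.

Lemma precs0 y u : prec y u [::] = false.
Proof. by case: u. Qed.

Lemma prec_rcons y u b x :
  size x <= size u -> prec y (rcons u b) x = prec y u x.
Proof. by elim: x u y => [|a x IH] [|c u] y //= le_xu; rewrite IH. Qed.

Lemma prefix_rcons x u b : size x <= size u -> prefix x (rcons u b) = prefix x u.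
Proof. by elim: x u => [|a x IH] [|c u] //= le_xu; rewrite IH. Qed.

(** The first mismatch of [u] and [v] falls either inside [x], where [v] agrees with [x], or after
    it. *)
Lemma prec_prefix y u v x : size x <= size u -> prec y u v -> prefix x v ->
  prec y u x || prefix x u.
Proof.
elim: u v x y => [|a u IH] [|b v] [|c x] y //= le_xu.
rewrite eq_sym [b == a]eq_sym; case: eqVneq => [<-|neq_ab].
  by case: eqVneq => [<-|_] //= uv /(IH _ _ _ le_xu uv).
by move=> pi_ab /andP[/eqP-> _]; rewrite (negbTE neq_ab) pi_ab.
Qed.

Lemma prec_index y il d k v : total_order (pi y) -> sorted (pi y) il ->
  uniq il -> d \in il -> k < size il ->
  prec y (d :: v) [:: nth d il k] = (index d il < k).
Proof.
move=> [_ asym tr _] il_sorted il_uniq d_il lt_k /=.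
have nth_il : nth d il k \in il by exact: mem_nth.
case: eqVneq => [{2}->|neq]; first by rewrite index_uniq // ltnn precs0.
rewrite -[k in RHS](index_uniq d lt_k il_uniq); case: ltngtP => [lt|lt|eq].
- exact: (sorted_ltn_index tr il_sorted).
- apply/negP => le; case/eqP: neq; apply: asym; rewrite le.
  exact: (sorted_ltn_index tr il_sorted).
- by case/eqP: neq; rewrite -{1}(nth_index d d_il) eq nth_index.
Qed.

Section Total.
Hypothesis pi_total : forall y, total_order (pi y).

Lemma prec_trans y v u x : prec y u v -> prec y v x -> prec y u x.
Proof.
elim: u v x y => [|a u IH] [|b v] [|c x] y //=.
have [_ asym tr _] := pi_total y.
case: (eqVneq a b) => [<-|neq_ab]; first by case: eqVneq => // _; apply: IH.
case: (eqVneq b c) => [<-|neq_bc] ab bc; first by rewrite (negbTE neq_ab).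
case: (eqVneq a c) => [eq_ac|_]; last exact: tr bc.
by case/eqP: neq_ab; apply: asym; rewrite ab eq_ac.
Qed.

Lemma prec_total y u v : size u = size v -> [|| u == v, prec y u v | prec y v u].
Proof.
elim: u v y => [|a u IH] [|b v] y //= [size_uv]; rewrite eqseq_cons.
rewrite [b == a]eq_sym; case: eqVneq => [<-|_] /=; first exact: IH.
by have [_ _ _ tot] := pi_total y; apply: tot.
Qed.

End Total.

Section Local.
Variables (pi_eps : rel T) (pi_sym : T -> rel T).
Hypothesis pi_local : local_ordering pi pi_eps pi_sym.

Lemma prec_local y y' c u v :
  prec (rcons y c) u v = prec (rcons y' c) u v.
Proof.
elim: u v y y' c => [|a u IH] [|b v] y y' c //=.
by case: eqP => _; [apply: IH | rewrite !pi_local.2].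
Qed.

End Local.
End Comparison.

(** * The matrix: ranges, ranks and rotation of rows *)

Section Matrix.
Variables (T : eqType) (pi : seq T -> rel T) (s : seq T).
Hypothesis pi_total : forall y, total_order (pi y).
Local Notation M := (Mstar pi s).
Local Notation L := (BWTstar pi s).
Local Notation n := (size s).
Implicit Types (u v x y : seq T) (a b c : T).

(** As [prec] is false once [x] is exhausted, only rows before all extensions of [x] count, whether
    or not [x] prefixes a row. *)
Definition first_row x := count (prec pi [::] ^~ x) M.
Definition num_rows x := count (prefix x) M.
Definition symbol_rank c j := count_mem c (take j L).

Lemma perm_Mstar : perm_eq M (rotations s).
Proof. by rewrite /Mstar perm_sort. Qed.

Lemma size_Mstar : size M = n.
Proof. by rewrite (perm_size perm_Mstar) size_map size_iota. Qed.

Lemma size_row u : u \in M -> size u = n.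
Proof. by rewrite (perm_mem perm_Mstar) => /mapP[i _ ->]; rewrite size_rot. Qed.

Lemma Mstar_pairwise : pairwise (fun u v => (u == v) || prec pi [::] u v) M.
Proof.
rewrite /Mstar; set le := fun u v => (u == v) || precedes pi u v.
suff : pairwise le (sort le (rotations s)).
  by apply: sub_pairwise => u v; rewrite /le precedesE.
pose P := [pred u : seq T | size u == n].
have allP : all P (rotations s) by apply/allP=> _ /mapP[i _ ->]; rewrite inE size_rot.
rewrite -(@sorted_pairwise_in _ P); last by rewrite all_sort.
  (* Totality is available for words of equal length, hence the restriction to [P]. *)
  apply: (sort_sorted_in _ allP) => u v /eqP size_u /eqP size_v.
  have := prec_total pi_total [::] (etrans size_u (esym size_v)).
  by rewrite /le !precedesE [v == u]eq_sym; case: eqP.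
move=> v u x _ _ _; rewrite /le !precedesE.
case/orP=> [/eqP-> //|uv] /orP[/eqP<-|vx]; rewrite ?uv ?orbT //.
by rewrite (prec_trans pi_total uv vx) orbT.
Qed.

Lemma prec_down x : pairwise (fun u v => prec pi [::] v x ==> prec pi [::] u x) M.
Proof.
apply: sub_pairwise Mstar_pairwise => u v /orP[/eqP->|uv]; first exact: implybb.
by apply/implyP; apply: prec_trans.
Qed.

Lemma prec_prefix_down x : size x <= n ->
  pairwise (fun u v => prec pi [::] v x || prefix x v ==>
                       prec pi [::] u x || prefix x u) M.
Proof.
move=> le_xn; apply: (sub_in_pairwise (P := mem M)) Mstar_pairwise; last exact/allP.
move=> u v uM _ /orP[/eqP->|uv]; first exact: implybb.
apply/implyP=> /orP[vx|xv]; first by rewrite (prec_trans pi_total uv vx).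
by apply: (prec_prefix _ uv xv); rewrite (size_row uM).
Qed.

Lemma count_prec_prefix (Q : pred (seq T)) x :
  count (fun u => Q u && (prec pi [::] u x || prefix x u)) M =
  count (fun u => Q u && prec pi [::] u x) M + count (fun u => Q u && prefix x u) M.
Proof.
apply: count_add => u _; case xu: (prefix x u); last by rewrite orbF andbF addn0.
by rewrite (prefix_prec _ _ xu) andbF orbT.
Qed.

Lemma first_row_num_rows x :
  count (fun u => prec pi [::] u x || prefix x u) M = first_row x + num_rows x.
Proof. by have := count_prec_prefix predT x. Qed.

Lemma first_row_num_rows_le x : first_row x + num_rows x <= n.
Proof. by rewrite -first_row_num_rows -size_Mstar count_size. Qed.

Lemma is_range_first_row x : size x <= n ->
  is_range M x (if num_rows x == 0 then 0 else (first_row x).+1) (num_rows x).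
Proof.
move=> le_xn; rewrite /is_range has_count -/(num_rows x) lt0n.
case: eqP => [->|_] //= [|j]; first by [].
rewrite /= ltnS.
case: (ltnP j (size M)) => /= lt_j; last first.
  have := first_row_num_rows_le x; rewrite -size_Mstar; lia.
rewrite addSn ltnS -first_row_num_rows -(nth_pairwise [::] (prec_prefix_down le_xn)) //.
rewrite leqNgt -(nth_pairwise [::] (prec_down x)) //.
by case xu: (prefix x _); rewrite ?(prefix_prec _ _ xu) //; case: prec.
Qed.

Lemma is_range_long x : n < size x -> is_range M x 0 0.
Proof.
move=> lt_nx; rewrite /is_range; case: hasP => // -[u uM] /size_prefix.
by rewrite (size_row uM) leqNgt lt_nx.
Qed.

Hypothesis s_prim : primitive_string s.

Lemma size_s_gt0 : 0 < n. Proof. by case/andP: s_prim. Qed.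

Lemma symbol_rankE c j :
  symbol_rank c j = count (fun u => ohead (rev u) == Some c) (take j M).
Proof.
rewrite /symbol_rank /BWTstar.
have : all (fun u => 0 < size u) M.
  by apply/allP => u /size_row->; exact: size_s_gt0.
elim: M j => [|u M' IH] [|j] //= /andP[u_gt0 M'_gt0]; first by rewrite !take0.
by case: (lastP u) u_gt0 => // v b _; rewrite rev_rcons /= IH.
Qed.

Lemma symbol_rank_first c x : symbol_rank c (first_row x) =
  count (fun u => (ohead (rev u) == Some c) && prec pi [::] u x) M.
Proof. by rewrite symbol_rankE count_take_pairwise ?prec_down. Qed.

Lemma symbol_rank_end c x : size x <= n ->
  symbol_rank c (first_row x + num_rows x) =
  count (fun u => (ohead (rev u) == Some c) && (prec pi [::] u x || prefix x u)) M.
Proof.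
move=> le_xn.
by rewrite symbol_rankE -first_row_num_rows count_take_pairwise ?prec_prefix_down.
Qed.

(** Rotating once more shifts the index of each rotation by one, and the last one becomes [s]
    itself: the rows are permuted. *)
Lemma count_rot (Q : pred (seq T)) : count Q M = count (Q \o rot 1) M.
Proof.
suff rot_perm : perm_eq (rotations s) (map (rot 1) (rotations s)).
  by rewrite !(permP perm_Mstar) (permP rot_perm) count_map.
rewrite /rotations -map_comp.
have -> : map (rot 1 \o rot^~ s) (iota 0 n) = map (rot^~ s) (iota 1 n).
  rewrite (iotaDl 1 0) -map_comp; apply/eq_in_map => i.
  by rewrite mem_iota /= add0n add1n => lt_i; rewrite (rotS lt_i).
case: n size_s_gt0 (rot_size s) => // k _ rotk.
have := iotaD 1 k 1; rewrite addn1 add1n => ->.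
by rewrite map_cat /= rot0 rotk cats1 perm_sym perm_rcons.
Qed.

(** The ranks differ by the number of rows with prefix [x] and last symbol [c]. Rotated back, these
    are the rows c v with [x] a prefix of v; the bound on [x] keeps the final [c] out of that
    prefix. *)
Lemma num_rows_cons c x : size x < n ->
  num_rows (c :: x) =
  symbol_rank c (first_row x + num_rows x) - symbol_rank c (first_row x).
Proof.
move=> lt_xn; rewrite symbol_rank_end ?symbol_rank_first ?(ltnW lt_xn) //.
rewrite count_prec_prefix addKn count_rot; apply: eq_in_count => u /size_row size_u.
case: u size_u lt_xn => [<- //|b v <-] /= le_xv.
by rewrite rot1_cons rev_rcons prefix_rcons //= [Some b == _]eq_sym.
Qed.

Lemma first_row0 : first_row [::] = 0.
Proof.
by rewrite -[RHS](count_pred0 M); apply: eq_count => u /=; rewrite precs0.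
Qed.

Lemma num_rows0 : num_rows [::] = n.
Proof.
rewrite -size_Mstar; apply/eqP; rewrite -all_count; apply/allP => u _ /=.
exact: prefix0s.
Qed.

Lemma num_rows1 c : num_rows [:: c] = symbol_rank c n.
Proof.
rewrite num_rows_cons ?size_s_gt0 // num_rows0 first_row0 add0n.
by rewrite /symbol_rank take0 subn0.
Qed.

Lemma symbol_rank_le c j : symbol_rank c j <= n.
Proof.
rewrite symbol_rankE -size_Mstar (leq_trans (count_size _ _)) //.
by rewrite size_take_min geq_minr.
Qed.

Lemma symbol_rank_mono c i j : i <= j -> symbol_rank c i <= symbol_rank c j.
Proof.
by move=> le_ij; rewrite /symbol_rank -(subnKC le_ij) takeD count_cat leq_addr.
Qed.

Section LocalOrdering.
Variables (pi_eps : rel T) (pi_sym : T -> rel T).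
Hypothesis pi_local : local_ordering pi pi_eps pi_sym.

(** An equality of sums, since subtraction on naturals truncates. *)
Lemma first_row_cons c a x : size x + 2 <= n ->
  first_row [:: c, a & x] + symbol_rank c (first_row [:: a]) =
  first_row [:: c; a] + symbol_rank c (first_row (a :: x)).
Proof.
move=> le_xn; rewrite !symbol_rank_first.
rewrite [X in _ + X]count_rot [X in _ = _ + X]count_rot.
pose Q u := if u is b :: d :: v then
  [&& b == c, d == a & prec pi [:: a] v x] else false.
(* [Q] selects the rows [c a v] with [v] before [x] in the context [a]: they  *)
(* separate [c a x] from [c a] and, once rotated, [a x] from [a].             *)
have -> : first_row [:: c, a & x] = first_row [:: c; a] + count Q M.
  apply: count_add => -[|b [|d v]] _ //=; first by rewrite addn0.
  case: (eqVneq b c) => [->|_] /=; last by rewrite addn0.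
  case: (eqVneq d a) => [->|_] /=; last by rewrite addn0.
  (* Locality lets the context a replace the context c a. *)
  by rewrite precs0 add0n (prec_local pi_local [:: c] [::] a).
rewrite -addnA; congr (_ + _); apply/esym; apply: count_add => u /size_row size_u.
case: u size_u => [|b [|d v]] /= size_u; [lia|lia|].
rewrite rot1_cons rev_rcons /= cats1 prec_rcons ?precs0; last lia.
rewrite -[Some b == _]/(b == c); case: eqP => //= _.
by case: eqP => [->|_] //=; rewrite addn0.
Qed.

End LocalOrdering.

Section Increasing.
Variables (il : seq T) (d0 : T).
Hypothesis il_uniq : uniq il.
Hypothesis il_full : forall a, a \in il.

Lemma prec_nth0 y d v : sorted (pi y) il -> 0 < size il ->
  prec pi y (d :: v) [:: nth d0 il 0] = false.
Proof. by move=> *; rewrite (set_nth_default d) // prec_index. Qed.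

Lemma prec_nthS y d v k : sorted (pi y) il -> k.+1 < size il ->
  prec pi y (d :: v) [:: nth d0 il k.+1] =
  prec pi y (d :: v) [:: nth d0 il k] + (nth d0 il k == d) :> nat.
Proof.
move=> il_sorted lt_k; have lt_k' := ltnW lt_k.
rewrite !(set_nth_default d d0) // !prec_index //.
have -> : (nth d il k == d) = (index d il == k).
  apply/eqP/eqP => [{1}<-|<-]; first exact: index_uniq.
  exact: nth_index.
by lia.
Qed.

Lemma first_row1_0 : sorted (pi [::]) il -> 0 < size il ->
  first_row [:: nth d0 il 0] = 0.
Proof.
move=> il_sorted il_gt0; rewrite -[RHS](count_pred0 M); apply: eq_in_count => -[|b v] _ //.
exact: (prec_nth0 b v il_sorted il_gt0).
Qed.

Lemma first_row1_next k : sorted (pi [::]) il -> k.+1 < size il ->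
  first_row [:: nth d0 il k.+1] =
  first_row [:: nth d0 il k] + num_rows [:: nth d0 il k].
Proof.
move=> il_sorted lt_k; apply: count_add => -[|b v] _ //.
by have := prec_nthS b v il_sorted lt_k; rewrite /= prefix0s andbT.
Qed.

Lemma first_row2_0 c : sorted (pi [:: c]) il -> 0 < size il ->
  first_row [:: c; nth d0 il 0] = first_row [:: c].
Proof.
move=> il_sorted il_gt0; apply: eq_in_count => -[|b [|d v]] _ //=.
case: eqP => [->|_] //.
by have := prec_nth0 d v il_sorted il_gt0; rewrite /= => ->.
Qed.

Lemma first_row2_next c k : sorted (pi [:: c]) il -> k.+1 < size il ->
  first_row [:: c; nth d0 il k.+1] =
  first_row [:: c; nth d0 il k] + num_rows [:: c; nth d0 il k].
Proof.
move=> il_sorted lt_k; apply: count_add => -[|b [|d v]] _ //=.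
  by rewrite andbF addn0.
rewrite prefix0s andbT [c == b]eq_sym; case: eqP => [->|_]; last by rewrite addn0.
by have := prec_nthS d v il_sorted lt_k; rewrite /= => ->.
Qed.

End Increasing.
End Matrix.

(** * Arithmetic and layout of the order table *)

Lemma expn_lt_exp2 K : exists w0, forall w, w0 <= w -> w ^ K < 2 ^ w.
Proof.
exists (K.+1 ^ K.+1).+1 => w lt_w; have w_gt0 : 0 < w by apply: leq_trans lt_w.
suff le_w : w ^ K.+1 <= K.+1 ^ K.+1 * 2 ^ w.
  rewrite -(ltn_pmul2l w_gt0) -expnS (leq_ltn_trans le_w) //.
  by rewrite ltn_pmul2r ?expn_gt0.
(* Here w < (K + 1)(q + 1) <= (K + 1) 2 ^ q; the power K + 1 of this bound suffices since q (K + 1)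
   <= w. *)
set q := w %/ K.+1.
have le_wq : w <= K.+1 * 2 ^ q.
  rewrite (leq_trans (ltnW (ltn_ceil w (ltn0Sn K)))) // mulnC leq_pmul2l //.
  exact: ltn_expl.
rewrite (leq_trans (_ : _ <= (K.+1 * 2 ^ q) ^ K.+1)) ?leq_exp2r //.
by rewrite expnMn leq_pmul2l ?expn_gt0 // -expnM leq_pexp2l // leq_trunc_div.
Qed.

Lemma sub_add_wrap w a b c e : a + c = e + b -> b <= 2 ^ w -> e < 2 ^ w ->
  eval_op w Add (eval_op w Defs.Sub a b) c = e.
Proof.
move=> eq_sum le_b lt_e; rewrite /eval_op /Defs.wrap modnDml.
have -> : a + 2 ^ w - b + c = e + 2 ^ w by lia.
by rewrite modnDr modn_small.
Qed.

Lemma nth_flatten_uniform (T : Type) (x0 : T) m rows r k :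
  all (fun l => size l == m) rows -> r < size rows -> k < m ->
  nth x0 (flatten rows) (m * r + k) = nth x0 (nth [::] rows r) k.
Proof.
elim: rows r => //= l rows IH r /andP[/eqP size_l size_rows] lt_r lt_k.
rewrite nth_cat size_l; case: r lt_r => [|r] lt_r; first by rewrite muln0 lt_k.
rewrite ltnNge mulnS -addnA leq_addr addKn /=; exact: IH.
Qed.

Section Increasing.
Variables (sigma : nat) (r : rel 'I_sigma).

Lemma size_increasing_list : size (increasing_list r) = sigma.
Proof. by rewrite size_sort size_enum_ord. Qed.

Lemma increasing_list_uniq : uniq (increasing_list r).
Proof. by rewrite sort_uniq enum_uniq. Qed.

Lemma mem_increasing_list a : a \in increasing_list r.
Proof. by rewrite mem_sort mem_enum. Qed.

Lemma increasing_list_sorted r' :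
  total_order r' -> r' =2 r -> sorted r' (increasing_list r).
Proof.
move=> [_ _ _ tot] rr'; rewrite (eq_sorted rr').
by apply: sort_sorted => a b; rewrite -!rr'; apply: tot.
Qed.

End Increasing.

Section Tables.
Variables (sigma : nat) (pi_eps : rel 'I_sigma) (pi_sym : 'I_sigma -> rel 'I_sigma).
Variable d0 : 'I_sigma.
Local Notation tab := (order_table pi_eps pi_sym).

Lemma nth_order_table0 k : k < sigma ->
  nth 0 tab (sigma * 0 + k) = val (nth d0 (increasing_list pi_eps) k).
Proof.
move=> lt_k; rewrite muln0 add0n /order_table /code map_cat nth_cat size_map.
by rewrite size_increasing_list lt_k (nth_map d0) ?size_increasing_list.
Qed.

Lemma nth_order_tableS (c : 'I_sigma) k : k < sigma ->
  nth 0 tab (sigma * c.+1 + k) = val (nth d0 (increasing_list (pi_sym c)) k).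
Proof.
move=> lt_k; rewrite mulnS -addnA /order_table /code map_cat nth_cat size_map.
rewrite size_increasing_list ltnNge leq_addr addKn map_flatten -map_comp /=.
set rows := map _ _.
have size_rows : all (fun l => size l == sigma) rows.
  by apply/allP => _ /mapP[a _ ->]; rewrite size_map size_increasing_list.
have nrows : size rows = sigma by rewrite size_map size_enum_ord.
rewrite (nth_flatten_uniform 0 size_rows) ?nrows // (nth_map c) ?size_enum_ord //.
by rewrite nth_ord_enum (nth_map d0) ?size_increasing_list.
Qed.

(** Each row lists the alphabet without repetition, whence the bound and the injectivity assumed in
    the preprocessing run. *)
Lemma order_table_row r : r <= sigma -> exists q, forall k, k < sigma ->
  nth 0 tab (sigma * r + k) = val (nth d0 (increasing_list q) k).
Proof.
case: r => [|r] le_r; first by exists pi_eps; exact: nth_order_table0.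
exists (pi_sym (Ordinal le_r)); exact: (nth_order_tableS (Ordinal le_r)).
Qed.

Lemma order_table_lt r k :
  r <= sigma -> k < sigma -> nth 0 tab (sigma * r + k) < sigma.
Proof. by move=> /order_table_row[q tabE] /tabE->; exact: ltn_ord. Qed.

Lemma order_table_inj r k k' : r <= sigma -> k < sigma -> k' < sigma ->
  nth 0 tab (sigma * r + k) = nth 0 tab (sigma * r + k') -> k = k'.
Proof.
move=> /order_table_row[q tabE] lt_k lt_k'; rewrite !tabE //.
move/val_inj/eqP; rewrite nth_uniq ?size_increasing_list //; first by move/eqP.
exact: increasing_list_uniq.
Qed.

End Tables.

(** * Correctness of the table and of a query *)

Section Correctness.
Variables (w sigma : nat) (s : seq 'I_sigma) (pi : seq 'I_sigma -> rel 'I_sigma).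
Variables (pi_eps : rel 'I_sigma) (pi_sym : 'I_sigma -> rel 'I_sigma).
Hypothesis s_word : size s < 2 ^ w.
Hypothesis s_prim : primitive_string s.
Hypothesis pi_total : forall y, total_order (pi y).
Hypothesis pi_local : local_ordering pi pi_eps pi_sym.
Local Notation n := (size s).
Local Notation L := (BWTstar pi s).
Local Notation tab := (order_table pi_eps pi_sym).
Local Notation first_row := (first_row pi s).
Local Notation num_rows := (num_rows pi s).

Lemma rank_symbol_rank (c : 'I_sigma) j : rank L c j = symbol_rank pi s c j.
Proof. by rewrite /rank /code -map_take count_map. Qed.

Lemma sorted_eps : sorted (pi [::]) (increasing_list pi_eps).
Proof. by apply: increasing_list_sorted; last exact: pi_local.1. Qed.

Lemma sorted_sym c : sorted (pi [:: c]) (increasing_list (pi_sym c)).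
Proof. by apply: increasing_list_sorted; last exact: (pi_local.2 [::]). Qed.

Lemma range_word x : first_row x + num_rows x < 2 ^ w.
Proof. exact: leq_ltn_trans (first_row_num_rows_le _ _ _) s_word. Qed.

Lemma first_row_word x : first_row x < 2 ^ w.
Proof. exact: leq_ltn_trans (leq_addr _ _) (range_word x). Qed.

Lemma rank_word (c : 'I_sigma) j : rank L c j <= 2 ^ w.
Proof.
rewrite rank_symbol_rank; apply: leq_trans (ltnW s_word).
exact: symbol_rank_le.
Qed.

Lemma acc1_first_row (d0 : 'I_sigma) k : k < sigma ->
  acc1 w tab (rank L) n sigma k = first_row [:: nth d0 (increasing_list pi_eps) k].
Proof.
have full := @mem_increasing_list _ pi_eps.
have uni := @increasing_list_uniq _ pi_eps.
elim: k => [|k IH] lt_k /=.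
  by rewrite first_row1_0 ?sorted_eps ?size_increasing_list.
rewrite (nth_order_table0 _ _ d0 (ltnW lt_k)) IH ?(ltnW lt_k) // rank_symbol_rank.
rewrite -(num_rows1 pi_total s_prim) add_small ?range_word //.
by rewrite first_row1_next ?sorted_eps ?size_increasing_list.
Qed.

Variable b : nat -> nat.
Hypothesis b_acc1 : forall k, k < sigma ->
  b (nth 0 tab (sigma * 0 + k)) = acc1 w tab (rank L) n sigma k.

Lemma b_first_row (c : 'I_sigma) : b c = first_row [:: c].
Proof.
set il := increasing_list pi_eps.
have c_il : c \in il by exact: mem_increasing_list.
have lt_c : index c il < sigma
  by rewrite -[X in _ < X](size_increasing_list pi_eps) index_mem.
have := b_acc1 lt_c; rewrite (nth_order_table0 _ _ c) // (acc1_first_row c) //.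
by rewrite nth_index.
Qed.

(** The bound on [n] lets [num_rows_cons] apply to one-symbol words. For n = 1 no pair entry is ever
    read, as longer queries are answered at once. *)
Lemma acc2_first_row (c : 'I_sigma) k : 1 < n -> k < sigma ->
  acc2 w tab (rank L) n sigma b c k =
  first_row [:: c; nth c (increasing_list (pi_sym c)) k].
Proof.
have full := @mem_increasing_list _ (pi_sym c).
have uni := @increasing_list_uniq _ (pi_sym c).
move=> n_gt1; elim: k => [|k IH] lt_k /=.
  by rewrite first_row2_0 ?sorted_sym ?size_increasing_list ?b_first_row.
rewrite (nth_order_tableS _ _ c _ (ltnW lt_k)) IH ?(ltnW lt_k) // b_first_row.
rewrite first_row2_next ?sorted_sym ?size_increasing_list // !rank_symbol_rank.
set a := nth c _ k.
rewrite -(num_rows1 pi_total s_prim)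
  (@add_small w (first_row [:: a]) (num_rows [:: a])) ?range_word //.
apply: sub_add_wrap; last exact: range_word.
  rewrite (num_rows_cons pi_total s_prim) // -addnA subnK //.
  by apply: symbol_rank_mono; rewrite leq_addr.
by rewrite -rank_symbol_rank rank_word.
Qed.

Variable m : nat -> nat.
Hypothesis m_table : table_upto w tab (rank L) n sigma b m (sigma ^ 2).

Lemma table1 (c : 'I_sigma) : m c = first_row [:: c].
Proof. by rewrite m_table.1 // b_first_row. Qed.

Lemma table2 (c a : 'I_sigma) : 1 < n ->
  m (sigma * c.+1 + a) =
  eval_op w Defs.Sub (first_row [:: c; a]) (rank L c (first_row [:: a])).
Proof.
move=> n_gt1; set il := increasing_list (pi_sym c).
have a_il : a \in il by exact: mem_increasing_list.
have lt_a : index a il < sigma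
  by rewrite -[X in _ < X](size_increasing_list (pi_sym c)) index_mem.
have := m_table.2 c (index a il) (ltn_ord c) lt_a.
rewrite acc2_first_row // (nth_order_tableS _ _ c) // nth_index // b_first_row.
apply; have := ltn_ord c; nia.
Qed.

Variables (x : seq 'I_sigma) (t : nat).
Hypothesis sigma_word : sigma ^ 2 + sigma < 2 ^ w.
Hypothesis x_word : size x < 2 ^ w.
Hypothesis t_le : t <= sigma ^ 2 + sigma.

Lemma query_correct : exists k r t',
  [/\ k <= 40 * maxn 1 (size x),
      run w (code x) (rank L) query_program k (start [:: n; sigma; size x] m t) =
        Config 31 r m t',
      t' <= sigma ^ 2 + sigma & is_range (Mstar pi s) x (r 0) (r 1)].
Proof.
have s_gt0 := size_s_gt0 s_prim.
have sigma_gt0 : 0 < sigma by case: (s) s_gt0 => // -[i lt_i] _ _; apply: leq_trans lt_i.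
have size_code : size (code x) = size x by rewrite size_map.
have code_lt i : i < size (code x) -> nth 0 (code x) i < sigma.
  move=> lt_i; have /mapP[a _ ->] := mem_nth 0 lt_i; exact: ltn_ord.
have code_word : size (code x) < 2 ^ w by rewrite size_code.
rewrite -size_code.
have [x0|x_gt0] := posnP (size (code x)).
  have [r [runE r0 r1]] :=
    query_run_empty (rank L) n m t sigma_gt0 sigma_word (size0nil x0).
  exists 4, r, t; split=> //; first by rewrite x0.
  have := @is_range_first_row _ pi s pi_total [::] (leq0n _).
  rewrite first_row0 num_rows0 gtn_eqF // r0 r1.
  by have -> : x = [::] by apply: size0nil; rewrite -size_code.
have [le_xn|lt_nx] := leqP (size (code x)) n; last first.
  have [r [runE r0 r1]] := query_run_long (rank L) m t sigma_gt0 sigma_word lt_nx.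
  exists 5, r, t; split=> //; first lia.
  by rewrite r0 r1; apply: is_range_long; rewrite -size_code.
have [d0 _] : exists d0 : 'I_sigma, True by case: (x) x_gt0 => // d0; exists d0.
have nth_code i : i < size (code x) -> nth 0 (code x) i = nth d0 x i.
  by rewrite size_code => lt_i; rewrite (nth_map d0).
have dropE i : i < size (code x) -> drop i x = nth d0 x i :: drop i.+1 x.
  by rewrite size_code => lt_i; rewrite (drop_nth d0).
have last_lt : (size (code x)).-1 < size (code x) by rewrite prednK.
have drop_last : drop (size (code x)).-1 x = [:: nth d0 x (size (code x)).-1].
  by rewrite dropE // prednK // size_code drop_size.
have [||i lt_i|i lt_i|//||r [t' [runE le_t' r0 r1]]] :=
  @query_run w (code x) (rank L) n sigma m t
    (fun i => first_row (drop i x)) (fun i => num_rows (drop i x))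
    sigma_gt0 sigma_word code_word t_le code_lt.
- by rewrite nth_code // drop_last table1.
- by rewrite nth_code // drop_last rank_symbol_rank num_rows1.
- have lt_i' := ltnW lt_i; rewrite !nth_code // table2; last lia.
  rewrite (dropE i) // (dropE i.+1) //.
  apply: sub_add_wrap; [|exact: rank_word|exact: first_row_word].
  rewrite !rank_symbol_rank -(first_row_cons pi_total s_prim pi_local) //.
  by apply: leq_trans le_xn; rewrite size_drop -size_code; lia.
- have lt_i' := ltnW lt_i; rewrite !nth_code // add_small ?range_word //.
  rewrite sub_small ?rank_symbol_rank.
    rewrite (dropE i) // num_rows_cons //.
    by apply: leq_trans le_xn; rewrite size_drop -size_code; lia.
  rewrite symbol_rank_mono ?leq_addr //=.
  exact: leq_ltn_trans (symbol_rank_le _ s_prim _ _) s_word.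
- by rewrite x_gt0.
(* B x + l x < 2 ^ w and l x > 0, so B x + 1 does not overflow. *)
- by have := range_word (drop 0 x); rewrite -lt0n /=; lia.
exists (8 + (size (code x)).-1 * 14 + 5), r, t'; split=> //; first lia.
by rewrite r0 r1 drop0; apply: is_range_first_row; rewrite -?size_code.
Qed.

End Correctness.

Theorem theorem19 :
  exists (preprocess query : program) (C : nat),
  forall K : nat, exists w0 : nat,
  forall (w sigma n : nat) (s : n.-tuple 'I_sigma)
         (pi : seq 'I_sigma -> rel 'I_sigma)
         (pi_eps : rel 'I_sigma) (pi_sym : 'I_sigma -> rel 'I_sigma),
    w0 <= w -> sigma <= w ^ K -> n < 2 ^ w ->
    primitive_string s ->
    (forall y, total_order (pi y)) ->
    local_ordering pi pi_eps pi_sym ->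
    let M := Mstar pi s in
    let L := BWTstar pi s in
    let cf := run w (order_table pi_eps pi_sym) (rank L) preprocess
                (C * sigma ^ 2) (start [:: n; sigma] (fun=> 0) 0) in
    [/\ halted preprocess cf,
        top cf <= C * sigma ^ 2 &
        forall xs : seq (seq 'I_sigma),
          (forall x, x \in xs -> size x < 2 ^ w) ->
          answers w n M L query C (top cf) (memory cf) xs].
Proof.
(* Preprocessing takes 13 sigma^2 + 15 sigma + 7 steps, a query at most 14 per symbol (at least one
   symbol being charged), and memory stays within 2 sigma^2 cells; 40 is a generous common bound. *)
exists preprocess_program, query_program, 40 => K.
(* For w >= 2, sigma^2 + sigma <= 2 w^(2K) <= w^(2K + 1), so addresses fit in a word. *)
have [w1 exp_lt] := expn_lt_exp2 (2 * K + 1).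
exists (maxn 2 w1) => w sigma n s pi pi_eps pi_sym.
rewrite geq_max => /andP[w_gt1 le_w1] sigma_le n_word s_prim pi_total pi_local M L.
have size_s : size s = n by rewrite size_tuple.
have s_gt0 := size_s_gt0 s_prim.
have [d0 _] : exists d0 : 'I_sigma, True.
  by case: (tval s) s_gt0 => // d0 _ _; exists d0.
have sigma_gt0 : 0 < sigma by apply: leq_trans (ltn_ord d0).
have sigma_word : sigma ^ 2 + sigma < 2 ^ w.
  apply: leq_ltn_trans (exp_lt w le_w1).
  rewrite mulnC expnD expn1 expnM.
  have := leq_mul sigma_le sigma_le; rewrite mulnn.
  have := leq_pmulr (w ^ K) (n := w ^ K).
  nia.
have [r [m [t [b [runE t_le m_table b_acc1]]]]] :=
  preprocess_run (rank L) n sigma_gt0 sigma_word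
    (order_table_lt pi_eps pi_sym d0)
    (@order_table_inj sigma pi_eps pi_sym d0).
set T := _ + 2 in runE.
rewrite (run_halted _ (k := T)); last first.
- by rewrite runE.
- by rewrite /T; nia.
rewrite runE /=; split=> //; first by nia.
rewrite -size_s in n_word m_table b_acc1 *.
elim=> //= x xs IH xs_word.
have x_word : size x < 2 ^ w by apply: xs_word; rewrite mem_head.
have [k [r' [t' [le_k qrunE t'_le x_range]]]] :=
  query_correct n_word s_prim pi_total pi_local b_acc1 m_table sigma_word x_word t_le.
rewrite (run_halted le_k) qrunE //; split=> //=; first by nia.
by apply: IH => y y_xs; apply: xs_word; rewrite inE y_xs orbT.
Qed.
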